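(* Let $\Gamma$ be a graph on $n\geq 2$ vertices. The eigenvalues of $A_{Lz}(\Gamma)$ are symmetric about the origin if and only if there exists a non-trivial partition of $V(\Gamma)$ into two sets $X$ and $Y$ such that one of the following is true. 1. Both $X$ and $Y$ form cliques with all vertices of full degree. 2. $X$ forms a clique with all vertices of full degree, and $Y$ induces an independent set. 3. $Y$ forms a clique with all vertices of full degree, and $X$ induces an independent set. 4. Both $X$ and $Y$ induce independent sets. (Here, if no edges are present between $X$ and $Y$, then $\Gamma=\overline{K_n}$; if there are some edges between $X$ and $Y$, then $\Gamma$ is bipartite.)
   Context: Graphs are finite, simple and undirected. For a graph $\Gamma$ on $n$ vertices, $d_\Gamma(u)$ is the degree of $u$ in $\Gamma$ and $d_{\overline{\Gamma}}(u)=n-1-d_\Gamma(u)$ is its degree in the complement $\overline{\Gamma}$. The Lanzhou matrix $A_{Lz}(\Gamma)$ is the real symmetric $n\times n$ matrix indexed by vertices whose $(u,v)$ entry is $d_\Gamma(u)d_{\overline{\Gamma}}(u)+d_\Gamma(v)d_{\overline{\Gamma}}(v)$ if $u$ and $v$ are adjacent in $\Gamma$, and $0$ otherwise. The eigenvalues of a real symmetric matrix are symmetric about the origin if, whenever $\lambda$ is an eigenvalue with multiplicity $k$, $-\lambda$ is also an eigenvalue with multiplicity $k$. A vertex has full degree if its degree in $\Gamma$ is $n-1$. A non-trivial partition means $X\cup Y=V(\Gamma)$, $X\cap Y=\emptyset$, with $X$ and $Y$ both nonempty. A single vertex counts both as a clique and as an independent set. *)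

(* Defs.v *)
From HB Require Import structures.
From mathcomp Require Import all_boot all_order all_algebra.
From mathcomp Require Import reals.

Set Implicit Arguments.
Unset Strict Implicit.
Unset Printing Implicit Defensive.

Import Order.TTheory GRing.Theory Num.Theory.

Record sgraph (V : finType) := SGraph {
  adj : rel V;
  adj_sym : symmetric adj;
  adj_irr : irreflexive adj
}.

Section Graphs.
Variable V : finType.
Implicit Types (G : sgraph V) (u v : V) (X Y : {set V}).

Definition compl_rel (r : rel V) : rel V := [rel u v | (u != v) && ~~ r u v].

Lemma compl_rel_sym r : symmetric r -> symmetric (compl_rel r).
Proof. by move=> rS u v; rewrite /compl_rel /= eq_sym rS. Qed.

Lemma compl_rel_irr r : irreflexive (compl_rel r).
Proof. by move=> u; rewrite /compl_rel /= eqxx. Qed.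

Definition compl_graph G : sgraph V :=
  SGraph (compl_rel_sym (@adj_sym _ G)) (@compl_rel_irr (adj G)).

Lemma neq_sym : symmetric (fun u v : V => u != v).
Proof. by move=> u v; rewrite eq_sym. Qed.

Lemma neq_irr : irreflexive (fun u v : V => u != v).
Proof. by move=> u; rewrite eqxx. Qed.

Definition complete_graph : sgraph V := SGraph neq_sym neq_irr.

Definition deg G u : nat := #|[set v | adj G u v]|.

Lemma deg_compl G u : deg (compl_graph G) u = (#|V| - 1 - deg G u)%N.
Proof.
have -> : (#|V| - 1)%N = #|[set~ u]| by rewrite cardsC1 subn1.
have sub : [set v | adj G u v] \subset [set~ u].
  by apply/subsetP => v; rewrite !inE; apply: contraTneq => ->; rewrite adj_irr.
rewrite /deg -(setIidPr sub) -cardsD; apply: eq_card => v.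
by rewrite !inE /= eq_sym andbC.
Qed.

Definition full_degree G u : Prop := deg G u = (#|V| - 1)%N.

Definition all_full_degree G X : Prop := {in X, forall u, full_degree G u}.

Definition clique G X : Prop := {in X &, forall u v, u != v -> adj G u v}.

Definition independent G X : Prop := {in X &, forall u v, ~~ adj G u v}.

Definition nontrivial_partition X Y : Prop :=
  [/\ X :|: Y = [set: V], X :&: Y = set0, X != set0 & Y != set0].

(* A part of a bipartition may be empty. *)
Definition bipartite G : Prop :=
  exists X Y, [/\ X :|: Y = [set: V], X :&: Y = set0,
                  independent G X & independent G Y].

End Graphs.

Local Open Scope ring_scope.

Definition lanzhou_mx (R : realType) (n : nat) (G : sgraph 'I_n) : 'M[R]_n :=
  \matrix_(u, v)
    if adj G u v then
      (deg G u * deg (compl_graph G) u + deg G v * deg (compl_graph G) v)%:R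
    else 0.

(* Multiplicity is algebraic: the order of lambda as a root of the
   characteristic polynomial; for a symmetric real matrix it is also the
   dimension of the eigenspace. *)
Definition symmetric_spectrum (R : realType) (n : nat) (A : 'M[R]_n) : Prop :=
  forall (lambda : R) (k : nat),
    eigenvalue A lambda -> mup lambda (char_poly A) = k ->
    eigenvalue A (- lambda) /\ mup (- lambda) (char_poly A) = k.

(* Main.v *)
Require Import Defs.
From mathcomp Require Import all_boot all_order all_algebra.
From mathcomp Require Import reals.
From mathcomp Require Import sesquilinear spectral complex boolp.

Set Implicit Arguments.
Unset Strict Implicit.
Unset Printing Implicit Defensive.

Import Order.TTheory GRing.Theory Num.Theory.

(* A real symmetric matrix is diagonalizable over the reals, so if its spectrum
   is symmetric, all its odd powers have trace 0.  For a nonnegative matrix this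
   says that there is no closed walk of odd length along nonzero entries, i.e.
   the graph H of nonzero entries is bipartite.  Conversely, a symmetric matrix
   A with bipartite H satisfies S A = -A S for a diagonal sign matrix S.

   An entry of the Lanzhou matrix vanishes on an edge exactly when both ends
   have full degree.  Hence H is the whole graph if no vertex has full degree;
   otherwise, an edge between two vertices that are not of full degree would
   span, with any vertex of full degree, a triangle in H. *)

Local Open Scope ring_scope.

(** * Real diagonalization and similarity invariants *)

(** The complexified matrix is Hermitian, so the spectral theorem diagonalizes it with a real
    diagonal. Real matrices similar over [R[i]] are similar through a real matrix, and real parts
    bring everything back to [R]. *)
Lemma real_symmetric_diagonalizable (R : rcfType) (n : nat) (A : 'M[R]_n) :
  A^T = A -> exists P d, P \in unitmx /\ P *m A = diag_mx d *m P.
Proof.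
move=> Asym; pose AC : 'M[R[i]]_n := map_mx (real_complex R) A.
have ACreal : AC \is a mxOver Num.real.
  by apply/mxOverP => i j; rewrite mxE; apply/complex_realP; exists (A i j).
have ACherm : AC \is hermsymmx.
  apply: realsym_hermsym => //; apply/is_hermitianmxP.
  by rewrite expr0 scale1r map_mx_id // map_trmx Asym.
have dreal := hermitian_spectral_diag_real ACherm.
have simAC : similar_in unitmx AC (diag_mx (spectral_diag AC)).
  exists (spectralmx AC); first exact: spectral_unit.
  apply/similarP; first exact: spectral_unit.
  have /orthomx_spectralP AE := hermitian_normalmx ACherm.
  by rewrite [X in _ *m X = _]AE !mulmxA mulmxV ?spectral_unit // mul1mx.
have Dreal : diag_mx (spectral_diag AC) \is a mxOver Num.real.
  by apply/mxOverP => i j; rewrite mxE rpredMn //; apply: (mxOverP dreal).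
have [P /andP[Preal Punit]] := real_similar simAC ACreal Dreal.
move=> /(similarP Punit) PA.
pose re m p (M : 'M[R[i]]_(m, p)) := map_mx (@complex.Re R) M.
have reK m p (M : 'M[R[i]]_(m, p)) : M \is a mxOver Num.real ->
    map_mx (real_complex R) (re m p M) = M.
  by move=> /mxOverP Mr; apply/matrixP => i j; rewrite !mxE RRe_real.
exists (re _ _ P), (re _ _ (spectral_diag AC)); split.
  by rewrite -(map_unitmx (real_complex R)) reK.
apply: (map_mx_inj (f := real_complex R)).
by rewrite !map_mxM map_diag_mx !reK.
Qed.

(** The relation lifts to the characteristic matrices; on taking determinants, the nonzero constant
    [\det P] cancels. *)
Lemma char_poly_similar (R : idomainType) (n : nat) (P A B : 'M[R]_n) :
  \det P != 0 -> P *m A = B *m P -> char_poly A = char_poly B.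
Proof.
move=> P0 PA.
have : map_mx polyC P *m char_poly_mx A = char_poly_mx B *m map_mx polyC P.
  by rewrite mulmxBr mulmxBl -!map_mxM PA scalar_mxC.
move/(congr1 determinant); rewrite !det_mulmx mulrC det_map_mx.
by apply: mulIf; rewrite polyC_eq0.
Qed.

Lemma char_poly_diag (R : comNzRingType) (n : nat) (d : 'rV[R]_n) :
  char_poly (diag_mx d) = \prod_(a <- codom (d 0)) ('X - a%:P).
Proof.
rewrite char_poly_trig ?diag_mx_is_trig // big_image /=.
by apply: eq_bigr => i _; rewrite mxE eqxx.
Qed.

Lemma mxtrace_similar (R : comUnitRingType) (n : nat) (P A B : 'M[R]_n) :
  P \in unitmx -> P *m A = B *m P -> \tr A = \tr B.
Proof.
move=> Pu PA; rewrite -[A](mulKmx Pu) PA mxtrace_mulC -mulmxA mulmxV //.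
by rewrite mulmx1.
Qed.

Lemma similar_exp (R : pzRingType) (n : nat) (P A B : 'M[R]_n) k :
  P *m A = B *m P -> P *m (A ^+ k) = (B ^+ k) *m P.
Proof.
move=> PA; elim: k => [|k IHk]; first by rewrite !expr0 mulmx1 mul1mx.
by rewrite !exprS -!mulmxE mulmxA PA -!mulmxA IHk.
Qed.

Lemma diag_mx_exp (R : pzRingType) (n : nat) (d : 'rV[R]_n) k :
  diag_mx d ^+ k = diag_mx (\row_i d 0 i ^+ k).
Proof.
elim: k => [|k IHk].
  by apply/matrixP => i j; rewrite expr0 !mxE expr0.
rewrite exprS IHk -mulmxE mulmx_diag; congr diag_mx.
by apply/rowP => i; rewrite !mxE exprS.
Qed.

(** * Spectra symmetric about the origin *)

Lemma char_poly_neq0 (R : idomainType) (n : nat) (A : 'M[R]_n) :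
  char_poly A != 0.
Proof. exact/monic_neq0/char_poly_monic. Qed.

Lemma symmetric_spectrumP (R : realType) (n : nat) (A : 'M[R]_n) :
  symmetric_spectrum A <->
  forall a, mup (- a) (char_poly A) = mup a (char_poly A).
Proof.
have eigE a : eigenvalue A a = (0 < mup a (char_poly A))%N.
  by rewrite eigenvalue_root_char -dvdp_XsubCl XsubC_dvd ?char_poly_neq0.
split=> [symA a | mupN a k Aa <-]; last by rewrite eigE mupN -eigE.
have [Aa | /negP] := boolP (eigenvalue A a).
  by have [] := symA a _ Aa erefl.
have [Aa | ] := boolP (eigenvalue A (- a)).
  by have [] := symA _ _ Aa erefl; rewrite opprK.
by rewrite !eigE -!eqn0Ngt => /eqP-> /negP; rewrite -eqn0Ngt => /eqP->.
Qed.

Lemma count_mem_opp (V : zmodType) (a : V) (s : seq V) :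
  count_mem a (map -%R s) = count_mem (- a) s.
Proof. by rewrite count_map; apply: eq_count => b /=; rewrite eqr_oppLR. Qed.

(** The trace is the sum of the [k]-th powers of the eigenvalues. Negation permutes the list of
    eigenvalues, so for odd [k] this sum is its own opposite. *)
Lemma odd_trace_eq0 (R : realType) (n : nat) (A : 'M[R]_n) k :
  A^T = A -> symmetric_spectrum A -> odd k -> \tr (A ^+ k) = 0.
Proof.
move=> Asym /symmetric_spectrumP mupN odd_k.
have [P [d [Pu PA]]] := real_symmetric_diagonalizable Asym.
have detP : \det P != 0 by rewrite -unitfE -unitmxE.
rewrite (mxtrace_similar Pu (similar_exp k PA)) diag_mx_exp mxtrace_diag.
under eq_bigr do rewrite mxE.
rewrite (char_poly_similar detP PA) char_poly_diag in mupN.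
set s := codom (d 0) in mupN.
have s_opp : perm_eq s (map -%R s).
  apply/allP => a _ /=; apply/eqP.
  by rewrite count_mem_opp -!mu_prod_XsubC mupN.
have -> : \sum_i d 0 i ^+ k = \sum_(a <- s) a ^+ k by rewrite big_image.
have sumN : \sum_(a <- s) a ^+ k = - \sum_(a <- s) a ^+ k.
  rewrite {1}(perm_big _ s_opp) big_map -sumrN; apply: eq_bigr => a _.
  by rewrite exprNn -signr_odd odd_k expr1 mulN1r.
by apply/eqP; rewrite -eqNr -sumN.
Qed.

(** Both characteristic polynomials split, with roots [d] and [- d]; unique factorization makes the
    two lists of roots agree up to order. *)
Lemma symmetric_spectrum_opp (R : realType) (n : nat) (A : 'M[R]_n) :
  A^T = A -> char_poly (- A) = char_poly A -> symmetric_spectrum A.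
Proof.
move=> Asym; have [P [d [Pu PA]]] := real_symmetric_diagonalizable Asym.
have detP : \det P != 0 by rewrite -unitfE -unitmxE.
have PNA : P *m (- A) = diag_mx (- d) *m P.
  by rewrite mulmxN PA -mulNmx; congr (_ *m _); apply/esym/raddfN.
move=> charN; apply/symmetric_spectrumP => a; move: charN.
rewrite (char_poly_similar detP PA) (char_poly_similar detP PNA) !char_poly_diag.
rewrite !mu_prod_XsubC => /prod_XsubC_eq/permP <-.
have -> : codom ((- d) 0) = map -%R (codom (d 0)).
  by rewrite -map_comp; apply: eq_map => i /=; rewrite mxE.
by rewrite count_mem_opp opprK.
Qed.

Lemma bipartite_symmetric_spectrum (R : realType) (n : nat) (A : 'M[R]_n)
    (X : {set 'I_n}) :
  A^T = A -> (forall u v, (u \in X) = (v \in X) -> A u v = 0) ->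
  symmetric_spectrum A.
Proof.
move=> Asym AX; apply: symmetric_spectrum_opp => //.
(* Conjugation by these signs negates exactly the entries between [X] and its complement; all others
   vanish. *)
pose d : 'rV[R]_n := \row_i (-1) ^+ (i \in X).
apply/esym/(@char_poly_similar _ _ (diag_mx d)).
  rewrite det_diag; apply/prodf_neq0 => i _.
  by rewrite mxE signr_eq0.
rewrite mul_diag_mx mul_mx_diag; apply/matrixP => u v; rewrite !mxE.
have [/AX -> | ] := eqVneq (u \in X) (v \in X); first by rewrite mulr0 oppr0 mul0r.
by case: (u \in X); case: (v \in X) => // _;
  rewrite ?expr0 ?expr1 ?mulN1r ?mulrN1 ?mul1r ?mulr1 ?opprK.
Qed.

(** * Walks seen through powers of a nonnegative matrix *)

Section NonnegativeMatrix.
Variables (R : realDomainType) (n : nat) (A : 'M[R]_n).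
Hypothesis A_ge0 : forall u v, 0 <= A u v.

Lemma mx_exp_ge0 k u v : 0 <= (A ^+ k) u v.
Proof.
elim: k u v => [|k IHk] u v; first by rewrite expr0 mxE ler0n.
by rewrite exprS -mulmxE mxE sumr_ge0 // => w _; rewrite mulr_ge0.
Qed.

(** Concatenation of walks: the summand at [w] is positive and no other summand is negative. *)
Lemma mx_exp_gt0D j k u w v :
  0 < (A ^+ j) u w -> 0 < (A ^+ k) w v -> 0 < (A ^+ (j + k)) u v.
Proof.
move=> juw kwv; rewrite exprD -mulmxE mxE (bigD1 w) //=.
by rewrite ltr_pwDl ?mulr_gt0 ?sumr_ge0 // => i _; rewrite mulr_ge0 ?mx_exp_ge0.
Qed.

Lemma connect_mx_exp u v :
  connect [rel x y | 0 < A x y] u v -> exists k, 0 < (A ^+ k) u v.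
Proof.
case/connectP => p + ->; elim: p u => [|w p IHp] u /=.
  by exists 0%N; rewrite expr0 mxE eqxx ltr01.
case/andP => uw /IHp [k wk]; exists k.+1.
by rewrite -add1n; apply: mx_exp_gt0D wk; rewrite expr1.
Qed.

(* Colour each vertex by the parity of the walks joining it to the
   representative of its connected component. *)
Lemma nonneg_mx_bipartite :
  A^T = A -> (forall k, odd k -> \tr (A ^+ k) = 0) ->
  exists X : {set 'I_n}, forall u v, (u \in X) = (v \in X) -> A u v = 0.
Proof.
move=> Asym tr0; pose e := [rel x y | 0 < A x y].
have symE u v : A u v = A v u by rewrite -[in RHS]Asym mxE.
have expE k u v : (A ^+ k) u v = (A ^+ k) v u.
  suff AkT : (A ^+ k)^T = A ^+ k by rewrite -[in RHS]AkT mxE.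
  elim: k => [|k IHk]; first by rewrite expr0 trmx1.
  by rewrite exprS -mulmxE trmx_mul IHk Asym mulmxE -exprSr exprS.
(* The diagonal entries are nonnegative with sum 0, so each is 0. *)
have no_odd k u : odd k -> ~~ (0 < (A ^+ k) u u).
  move=> /tr0 /eqP; rewrite psumr_eq0 => [/allP/(_ u)|i _]; last exact: mx_exp_ge0.
  by rewrite mem_index_enum => /(_ isT) /eqP ->; rewrite ltxx.
have e_sym : connect_sym e.
  by apply: sym_connect_sym => x y; rewrite /e /= symE.
pose r := fingraph.root e.
(* Walks of every length are allowed, so this boolean is obtained classically. *)
pose even_walk v := `[< exists2 k, ~~ odd k & 0 < (A ^+ k) (r v) v >].
have parity v : exists2 k, odd k = ~~ even_walk v & 0 < (A ^+ k) (r v) v.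
  rewrite /even_walk; case: asboolP => [[k /negbTE even_k kv] | not_even].
    by exists k.
  (* Without an even walk, whichever walk exists is odd. *)
  have [k kv] : exists k, 0 < (A ^+ k) (r v) v.
    by apply: connect_mx_exp; rewrite -/e e_sym connect_root.
  exists k => //; case: (boolP (odd k)) => // even_k.
  by case: not_even; exists k.
exists [set v | even_walk v] => u v.
rewrite !inE => eq_uv; apply/eqP/negPn/negP => Auv.
have {}Auv : 0 < A u v by rewrite lt_neqAle eq_sym Auv A_ge0.
have ruv : r u = r v by apply/eqP; rewrite root_connect //; apply: connect1.
have [j odd_j uj] := parity u; have [k odd_k vk] := parity v.
have A1 : 0 < (A ^+ 1) u v by rewrite expr1.
(* The walk to [v], reversed, closes up the walk to [u] followed by the edge from [u] to [v]. The
   total length is odd because [j] and [k] have the same parity. *)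
rewrite -ruv expE in vk.
have odd_closed : odd (j + 1 + k).
  by rewrite !oddD odd_j odd_k eq_uv addbT; case: (even_walk v).
move/negP: (no_odd _ (r u) odd_closed); apply.
exact: mx_exp_gt0D (mx_exp_gt0D uj A1) vk.
Qed.
End NonnegativeMatrix.

(** * Full degree and the entries of the Lanzhou matrix *)

Section FullDegree.
Variables (V : finType) (G : sgraph V).

Lemma neighbours_sub u : [set v | adj G u v] \subset [set~ u].
Proof.
by apply/subsetP => v; rewrite !inE; apply: contraTneq => ->; rewrite adj_irr.
Qed.

(** The neighbourhood lies in the complement of [u] and has the same cardinality. *)
Lemma full_degree_adj u v : full_degree G u -> u != v -> adj G u v.
Proof.
move=> full_u uv; suff: v \in [set v | adj G u v] by rewrite inE.
have -> : [set v | adj G u v] = [set~ u].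
  apply/eqP; rewrite eqEcard neighbours_sub cardsC1 -subn1.
  by rewrite -[X in (_ <= X)%N]/(deg G u) full_u leqnn.
by rewrite !inE eq_sym.
Qed.

Lemma all_full_degree_clique (X : {set V}) : all_full_degree G X -> clique G X.
Proof. by move=> fullX u v uX _; apply/full_degree_adj/fullX. Qed.

Lemma deg_compl_gt0 u : ~ full_degree G u -> (0 < deg (compl_graph G) u)%N.
Proof.
move=> /eqP not_full; rewrite deg_compl subn_gt0 ltn_neqAle not_full /=.
by rewrite -[(_ - 1)%N]/(#|V| - 1)%N subn1 -(cardsC1 u) subset_leq_card ?neighbours_sub.
Qed.

Lemma deg_gt0 u v : adj G u v -> (0 < deg G u)%N.
Proof. by move=> uv; apply/card_gt0P; exists v; rewrite inE. Qed.

End FullDegree.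

Section Lanzhou.
Variables (R : realType) (n : nat) (G : sgraph 'I_n).
Local Notation L := (lanzhou_mx R G).

Lemma lanzhou_mx_sym : L^T = L.
Proof. by apply/matrixP => u v; rewrite !mxE adj_sym addnC. Qed.

Lemma lanzhou_mx_ge0 u v : 0 <= L u v.
Proof. by rewrite mxE; case: ifP => // _; apply: ler0n. Qed.

(** The summand of [u] alone is positive: the edge gives [u] a neighbour, and [u] also has a
    non-neighbour. *)
Lemma lanzhou_mx_neq0 u v : adj G u v -> ~ full_degree G u -> L u v != 0.
Proof.
move=> uv not_full; rewrite mxE uv pnatr_eq0 addn_eq0 negb_and -lt0n.
by rewrite muln_gt0 (deg_gt0 uv) deg_compl_gt0.
Qed.

Lemma lanzhou_mx_full0 u v : full_degree G u -> full_degree G v -> L u v = 0.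
Proof.
move=> fu fv; rewrite mxE !deg_compl fu fv subnn !muln0.
by case: ifP.
Qed.

Lemma lanzhou_mx_nadj0 u v : ~~ adj G u v -> L u v = 0.
Proof. by move=> /negbTE uv; rewrite mxE uv. Qed.

End Lanzhou.

(** * Nontrivial partitions and the characterization *)

Lemma nontrivial_partitionC (V : finType) (X : {set V}) :
  X != set0 -> ~: X != set0 -> nontrivial_partition X (~: X).
Proof. by split=> //; rewrite ?setUCr ?setICr. Qed.

(** If one class is empty, the graph has no edges, and a singleton with its complement serves
    instead. *)
Lemma nontrivial_bipartition (V : finType) (G : sgraph V) (X : {set V}) :
  (2 <= #|V|)%N -> independent G X -> independent G (~: X) ->
  exists Y, [/\ nontrivial_partition Y (~: Y), independent G Y
              & independent G (~: Y)].
Proof.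
move=> V2 iX iXC.
have [/andP[X0 XC0] | trivX] := boolP ((X != set0) && (~: X != set0)).
  by exists X; split=> //; apply: nontrivial_partitionC.
have no_edge u v : ~~ adj G u v.
  move: trivX; rewrite negb_and !negbK => /orP[] /eqP E.
    by apply: iXC; rewrite E setC0 inE.
  by apply: iX; rewrite -[X]setCK E setC0 inE.
have /card_gt0P[u _] : (0 < #|V|)%N by apply: ltnW.
exists [set u]; split=> [||].
- apply: nontrivial_partitionC; first by apply/set0Pn; exists u; rewrite inE.
  by rewrite -card_gt0 cardsC1 -subn1 subn_gt0.
- by move=> x y _ _; apply: no_edge.
- by move=> x y _ _; apply: no_edge.
Qed.

Local Close Scope ring_scope.

Theorem theorem40 (R : realType) (n : nat) (hn : (2 <= n)%N)
    (G : sgraph 'I_n) :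
  (symmetric_spectrum (lanzhou_mx R G) <->
   exists X Y : {set 'I_n},
     nontrivial_partition X Y /\
     ((clique G X /\ all_full_degree G X) /\
        (clique G Y /\ all_full_degree G Y)
      \/ (clique G X /\ all_full_degree G X) /\ independent G Y
      \/ (clique G Y /\ all_full_degree G Y) /\ independent G X
      \/ independent G X /\ independent G Y))
  /\
  (forall X Y : {set 'I_n},
     nontrivial_partition X Y -> independent G X -> independent G Y ->
     ((forall u v, u \in X -> v \in Y -> ~~ adj G u v) ->
        adj G =2 adj (compl_graph (complete_graph 'I_n)))
     /\ ((exists u v, [/\ u \in X, v \in Y & adj G u v]) -> bipartite G)).
Proof.
have V2 : (2 <= #|'I_n|)%N by rewrite card_ord.
split; last first.
  move=> X Y [XY1 XY0 _ _] iX iY; split=> [noXY u v | _]; last by exists X, Y.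
  (* The complement of the complete graph has no edges, so it remains to exclude every edge of
     [G]. *)
  rewrite /= /compl_rel /= andbN; apply/negbTE.
  have /orP[uX|uY] : (u \in X) || (u \in Y) by rewrite -in_setU XY1 inE.
    have /orP[vX|vY] : (v \in X) || (v \in Y) by rewrite -in_setU XY1 inE.
      exact: iX.
    exact: noXY.
  have /orP[vX|vY] : (v \in X) || (v \in Y) by rewrite -in_setU XY1 inE.
    by rewrite adj_sym noXY.
  exact: iY.
split=> [symL | [X [Y [[XY1 XY0 _ _] XYcases]]]].
  have [C C0] := nonneg_mx_bipartite (@lanzhou_mx_ge0 R n G)
    (lanzhou_mx_sym R G) (fun k => odd_trace_eq0 (lanzhou_mx_sym R G) symL).
  have edge_col u v : adj G u v -> ~ full_degree G u -> (u \in C) != (v \in C).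
    by move=> uv /(lanzhou_mx_neq0 R uv); apply: contraNneq => /C0 ->.
  pose F := [set u | deg G u == #|'I_n| - 1].
  have fullF : all_full_degree G F by move=> u; rewrite inE => /eqP.
  have notF u : u \notin F -> ~ full_degree G u by rewrite inE => /eqP.
  (* With no vertex of full degree, every edge joins different colours, so both colour classes are
     independent. *)
  have [F0 | [f fF]] := set_0Vmem F.
    have not_full u : ~ full_degree G u by apply: notF; rewrite F0 inE.
    have [||Y [partY iY iYC]] := @nontrivial_bipartition _ G C V2.
    - move=> u v uC vC; apply/negP => uv.
      by move: (edge_col _ _ uv (not_full u)); rewrite uC vC.
    - move=> u v; rewrite !inE => /negbTE uC /negbTE vC; apply/negP => uv.
      by move: (edge_col _ _ uv (not_full u)); rewrite uC vC.
    by exists Y, (~: Y); split=> //; do 3!right.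
  (* The graph is complete here, and any nontrivial partition would do. *)
  have [FC0 | FCn0] := eqVneq (~: F) set0.
    have full_all (X : {set 'I_n}) : all_full_degree G X.
      by move=> u _; apply: fullF; rewrite -[F]setCK FC0 setC0 inE.
    exists [set f], (~: [set f]); split.
      apply: nontrivial_partitionC; first by apply/set0Pn; exists f; rewrite inE.
      by rewrite -card_gt0 cardsC1 -subn1 subn_gt0.
    by left; do !split=> //; apply: all_full_degree_clique.
  exists F, (~: F); split.
    by apply: nontrivial_partitionC => //; apply/set0Pn; exists f.
  right; left; split; first by split=> //; apply: all_full_degree_clique.
  (* An edge outside F would form a triangle of nonzero entries with f. *)
  move=> u v; rewrite !in_setC => uF vF; apply/negP => uv.
  have adjf w : w \notin F -> adj G w f.
    move=> wF; rewrite adj_sym; apply: full_degree_adj; first exact: fullF.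
    by apply: contraNneq wF => <-.
  have := edge_col _ _ uv (notF _ uF).
  have := edge_col _ _ (adjf _ uF) (notF _ uF).
  have := edge_col _ _ (adjf _ vF) (notF _ vF).
  (* Two colours cannot separate three vertices pairwise. *)
  by case: (u \in C); case: (v \in C); case: (f \in C).
apply: (@bipartite_symmetric_spectrum _ _ _ X); first exact: lanzhou_mx_sym.
have inY u : u \notin X -> u \in Y.
  by move=> uX; have := in_setT u; rewrite -XY1 inE (negbTE uX).
have block0 Z : all_full_degree G Z \/ independent G Z ->
    {in Z &, forall u v, lanzhou_mx R G u v = 0%R}.
  case=> [fullZ | iZ] u v uZ vZ; first by apply: lanzhou_mx_full0; apply: fullZ.
  by apply: lanzhou_mx_nadj0; apply: iZ.
(* In all four cases each part either has full degree throughout or is independent, so both diagonal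
   blocks vanish. *)
have [X0 Y0] : (all_full_degree G X \/ independent G X) /\
               (all_full_degree G Y \/ independent G Y) by tauto.
move=> u v; have [uX /esym vX | uX /esym/negbT vX] := boolP (u \in X).
  exact: (block0 X).
by apply: (block0 Y) => //; apply: inY.
Qed.
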